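(* Let $(Q,* )$ and $(Q',\cdot)$ be automorphic loops and let $f:(Q,* )\to(Q',\cdot)$ be a half-isomorphism. If $(Q',\cdot)$ satisfies condition (C), i.e. for all $a,b\in Q'$ one has $a\cdot(a\cdot b)=(b\cdot a)\cdot a$ if and only if $a\cdot b=b\cdot a$, then $f$ is trivial, i.e. $f$ is either an isomorphism or an anti-isomorphism.
   Context: A loop is a set $L$ with a binary operation such that for all $a,b\in L$ the equations $ax=b$ and $ya=b$ have unique solutions $x,y$, and there is a two-sided identity $1$. For $a\in L$ let $R_a:x\mapsto xa$ and $L_a:x\mapsto ax$. The multiplication group $\mathrm{Mlt}(L)$ is the permutation group generated by all $R_a,L_a$, and the inner mapping group is the stabilizer of $1$ in $\mathrm{Mlt}(L)$. A loop is automorphic if every inner mapping is an automorphism. A half-isomorphism between loops $(L,* )$ and $(L',\cdot)$ is a bijection $f:L\to L'$ with $f(x*y)\in\{f(x)\cdot f(y),\,f(y)\cdot f(x)\}$ for all $x,y\in L$. An anti-isomorphism is a bijection with $f(x*y)=f(y)\cdot f(x)$ for all $x,y$. A half-isomorphism is trivial if it is an isomorphism or an anti-isomorphism. *)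

(* Defs.v *)
From mathcomp Require Import ssreflect ssrfun.

Set Implicit Arguments.

Definition is_loop (T : Type) (m : T -> T -> T) (e : T) : Prop :=
  (forall a b : T, exists! x : T, m a x = b) /\
  (forall a b : T, exists! y : T, m y a = b) /\
  (forall x : T, m e x = x /\ m x e = x).

(* Mlt(L): the permutation group generated by all R_a : x |-> x a and
   L_a : x |-> a x.  Its elements are exactly the finite composites of the
   generators and their inverses; [mlt m f] says f is such a composite.
   In the inverse clauses, g is (extensionally) the inverse of R_a resp. L_a,
   since g is forced by unique solvability. *)
Inductive mlt (T : Type) (m : T -> T -> T) : (T -> T) -> Prop :=
| mlt_id : mlt m (fun x => x)
| mlt_R (f : T -> T) (a : T) : mlt m f -> mlt m (fun x => m (f x) a)
| mlt_L (f : T -> T) (a : T) : mlt m f -> mlt m (fun x => m a (f x))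
| mlt_Rinv (f g : T -> T) (a : T) :
    mlt m f -> (forall x, m (g x) a = x) -> mlt m (fun x => g (f x))
| mlt_Linv (f g : T -> T) (a : T) :
    mlt m f -> (forall x, m a (g x) = x) -> mlt m (fun x => g (f x)).

Definition inner_mapping (T : Type) (m : T -> T -> T) (e : T) (f : T -> T) :=
  mlt m f /\ f e = e.

Definition is_automorphism (T : Type) (m : T -> T -> T) (f : T -> T) : Prop :=
  bijective f /\ forall x y : T, f (m x y) = m (f x) (f y).

Definition automorphic_loop (T : Type) (m : T -> T -> T) (e : T) : Prop :=
  is_loop m e /\ forall f : T -> T, inner_mapping m e f -> is_automorphism m f.

Definition half_isomorphism (T T' : Type) (m : T -> T -> T) (m' : T' -> T' -> T')
  (f : T -> T') : Prop :=
  bijective f /\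
  forall x y : T, f (m x y) = m' (f x) (f y) \/ f (m x y) = m' (f y) (f x).

Definition isomorphism (T T' : Type) (m : T -> T -> T) (m' : T' -> T' -> T')
  (f : T -> T') : Prop :=
  bijective f /\ forall x y : T, f (m x y) = m' (f x) (f y).

Definition anti_isomorphism (T T' : Type) (m : T -> T -> T) (m' : T' -> T' -> T')
  (f : T -> T') : Prop :=
  bijective f /\ forall x y : T, f (m x y) = m' (f y) (f x).

Definition condC (T : Type) (m : T -> T -> T) : Prop :=
  forall a b : T, m a (m a b) = m (m b a) a <-> m a b = m b a.

(* Main.v *)
(* Pull the half-isomorphism back to a second automorphic loop B on the carrier
   of A, with x *B y in {x *A y, y *A x}.  The line identity
   (xy)^-1 (x y^-1) = ((xy)^-1 x)^2, compared in A and B, shows with (C) that B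
   agrees with A on (x, y) iff it does on (y, x).  So every noncommuting pair is
   either "iso" or "anti".  Suppose x is iso with y and anti with z.  The inner
   map T_x of A is then T_x of B at y, but the inverse of T_x of B at z, while
   each map is an automorphism; expanding T_x(yz) forces T_x^4 to fix y and z.
   Now z is anti with x and also noncommuting with y, which gives T_z^4 y = y,
   and a further application to yz or zy gives T_z^3 y = y: so y and z commute,
   a contradiction.  Hence each element is purely iso, purely anti or central,
   iso elements commute with anti ones, and the product of an anti and an iso
   element would be mixed. *)

Require Import Defs.
From mathcomp Require Import ssreflect ssrfun.
From Stdlib Require Import Classical ClassicalEpsilon.

Set Implicit Arguments.
Unset Strict Implicit.
Unset Printing Implicit Defensive.

(* The inner mappings used in the argument, required to be multiplicative, are
   L_x^-1 R_x, L_(xy)^-1 L_x L_y and R_(xy)^-1 R_y R_x; this form makes the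
   structure invariant under passing to the opposite loop. *)
Record aloop (T : Type) := ALoop {
  op : T -> T -> T;
  one : T;
  ld : T -> T -> T;
  rd : T -> T -> T;
  opld : forall a b, op a (ld a b) = b;
  ldop : forall a b, ld a (op a b) = b;
  oprd : forall a b, op (rd b a) a = b;
  rdop : forall a b, rd (op b a) a = b;
  op1l : forall a, op one a = a;
  op1r : forall a, op a one = a;
  inT : forall x u v,
    ld x (op (op u v) x) = op (ld x (op u x)) (ld x (op v x));
  inL : forall x y u v, ld (op x y) (op x (op y (op u v))) =
    op (ld (op x y) (op x (op y u))) (ld (op x y) (op x (op y v)));
  inR : forall x y u v, rd (op (op (op u v) x) y) (op x y) =
    op (rd (op (op u x) y) (op x y)) (rd (op (op v x) y) (op x y)) }.

Notation "x *[ A ] y" := (op A x y) (at level 40, A at level 200, left associativity).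

Definition inv T (A : aloop T) x := ld A x (one A).
Definition tm T (A : aloop T) x u := ld A x (u *[A] x).
Definition li T (A : aloop T) x y u := ld A (x *[A] y) (x *[A] (y *[A] u)).
Definition comm T (A : aloop T) x y := x *[A] y = y *[A] x.

Lemma opIl T (A : aloop T) x u v : x *[A] u = x *[A] v -> u = v.
Proof. by move=> e; rewrite -(ldop A x u) e ldop. Qed.

Lemma opIr T (A : aloop T) x u v : u *[A] x = v *[A] x -> u = v.
Proof. by move=> e; rewrite -(rdop A x u) e rdop. Qed.

Lemma inT_rd T (A : aloop T) x u v : rd A (x *[A] (u *[A] v)) x =
  rd A (x *[A] u) x *[A] rd A (x *[A] v) x.
Proof.
apply: (@opIr _ A x); rewrite oprd; apply: (@opIl _ A x).
have E w : ld A x (rd A (x *[A] w) x *[A] x) = w by rewrite oprd ldop.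
have H := inT A x (rd A (x *[A] u) x) (rd A (x *[A] v) x).
by rewrite !E in H; rewrite -H opld.
Qed.

(* Every statement about A is later also used for [opp A], whose operation is
   convertible to the reversed one; it exchanges the "iso" and "anti" cases. *)
Definition opp T (A : aloop T) : aloop T :=
  @ALoop T (fun a b => b *[A] a) (one A) (fun a b => rd A b a)
    (fun b a => ld A a b) (fun a b => oprd A a b) (fun a b => rdop A a b)
    (fun a b => opld A a b) (fun a b => ldop A a b) (op1r A) (op1l A)
    (fun x u v => inT_rd A x v u) (fun x y u v => inR A y x v u)
    (fun x y u v => inL A y x v u).

(** * Identities in one automorphic loop: flexibility, inverses, the line identity *)

Lemma tmP T (A : aloop T) x u : x *[A] tm A x u = u *[A] x.
Proof. exact: opld. Qed.

Lemma tmE T (A : aloop T) x u w : x *[A] w = u *[A] x -> tm A x u = w.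
Proof. by move=> e; apply: (@opIl _ A x); rewrite tmP. Qed.

Lemma tmM T (A : aloop T) x u v : tm A x (u *[A] v) = tm A x u *[A] tm A x v.
Proof. exact: inT. Qed.

Lemma tm_comm T (A : aloop T) x u : comm A x u <-> tm A x u = u.
Proof. by split=> e; [exact: tmE | rewrite /comm -{1}e tmP]. Qed.

Lemma tmxx T (A : aloop T) x : tm A x x = x.
Proof. exact: tmE. Qed.

Lemma flex T (A : aloop T) x y : x *[A] (y *[A] x) = (x *[A] y) *[A] x.
Proof. by rewrite -[RHS]tmP tmM tmxx tmP. Qed.

Lemma opV T (A : aloop T) x : x *[A] inv A x = one A.
Proof. exact: opld. Qed.

Lemma Vop T (A : aloop T) x : inv A x *[A] x = one A.
Proof. by apply: (@opIl _ A x); rewrite flex opV op1l op1r. Qed.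

Lemma invE T (A : aloop T) x y : x *[A] y = one A -> inv A x = y.
Proof. by move=> e; apply: (@opIl _ A x); rewrite opV. Qed.

Lemma invK T (A : aloop T) x : inv A (inv A x) = x.
Proof. exact: invE (Vop A x). Qed.

Lemma inv_opp T (A : aloop T) x : inv (opp A) x = inv A x.
Proof. by exact: (@invE _ (opp A) _ _ (Vop A x)). Qed.

Lemma morph_inv T (A : aloop T) (h : T -> T) u :
  {morph h : u v / u *[A] v} -> h (inv A u) = inv A (h u).
Proof.
move=> hM; symmetry; apply: invE; rewrite -hM opV.
by apply: (@opIl _ A (h (one A))); rewrite -hM !op1r.
Qed.

Lemma tmV T (A : aloop T) x u : tm A x (inv A u) = inv A (tm A x u).
Proof. exact/morph_inv/tmM. Qed.

Lemma commC T (A : aloop T) x y : comm A x y -> comm A y x.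
Proof. by []. Qed.

Lemma commV T (A : aloop T) x y : comm A x (inv A y) <-> comm A x y.
Proof.
split=> /tm_comm e; apply/tm_comm; last by rewrite tmV e.
by rewrite -(invK A y) tmV e.
Qed.

Lemma liP T (A : aloop T) x y u :
  (x *[A] y) *[A] li A x y u = x *[A] (y *[A] u).
Proof. exact: opld. Qed.

Lemma liE T (A : aloop T) x y u w :
  (x *[A] y) *[A] w = x *[A] (y *[A] u) -> li A x y u = w.
Proof. by move=> e; apply: (@opIl _ A (x *[A] y)); rewrite liP. Qed.

Lemma liM T (A : aloop T) x y : {morph li A x y : u v / u *[A] v}.
Proof. exact: inL. Qed.

Lemma li_fix T (A : aloop T) x y : li A x y x = x.
Proof. by apply: liE; rewrite flex. Qed.

Lemma li_V T (A : aloop T) x u : li A x (inv A x) u = x *[A] (inv A x *[A] u).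
Proof. by apply: liE; rewrite opV op1l. Qed.

(** The left side is the automorphism [li A x (inv A x)] at [u]; it fixes [x], so it commutes with
    left multiplication by [x]. *)
Lemma opVC T (A : aloop T) x u :
  x *[A] (inv A x *[A] u) = inv A x *[A] (x *[A] u).
Proof.
apply: (@opIl _ A x).
by rewrite -!li_V liM li_fix.
Qed.

Lemma invM T (A : aloop T) x y : inv A (x *[A] y) = inv A y *[A] inv A x.
Proof.
set w := x *[A] y; set z := li A x y (inv A y).
have wz : w *[A] z = x by rewrite /w /z liP opV op1r.
(* Both inner mappings unfold because [w z = x] and [z] is the image of the inverse of [y] under
   [li A x y]. *)
have key t : x *[A] li A w z (li A x y t) = x *[A] (inv A y *[A] (y *[A] t)).
  by rewrite -{1}wz liP /z -liM liP opVC.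
have fixV : li A w z (inv A w) = inv A w.
  by rewrite (morph_inv _ (liM A w z)) li_fix.
(* With this [t], [y t] is the inverse of [x], and [li A x y t] is the inverse of [w], which
   [li A w z] fixes. *)
set t := ld A y (ld A x (one A)).
have ht : li A x y t = inv A w by apply: liE; rewrite opV !opld.
by move: (opIl (key t)); rewrite ht fixV /t opld.
Qed.

(** By [invM], inversion turns the left side into [li A x (inv A x) (inv A u)], and automorphisms
    commute with inversion. *)
Lemma opVopr T (A : aloop T) x u :
  (u *[A] inv A x) *[A] x = x *[A] (inv A x *[A] u).
Proof.
have e : inv A ((u *[A] inv A x) *[A] x) = li A x (inv A x) (inv A u).
  by rewrite !invM invK li_V opVC.
by rewrite -(invK A (_ *[A] x)) e (morph_inv _ (liM A x (inv A x))) invK li_V.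
Qed.

Lemma opV_comm T (A : aloop T) x w :
  inv A x *[A] (w *[A] x) = (inv A x *[A] w) *[A] x.
Proof. by rewrite -[RHS]tmP tmM tmV tmxx opVC tmP. Qed.

Lemma line T (A : aloop T) x y : inv A (x *[A] y) *[A] (x *[A] inv A y) =
  (inv A (x *[A] y) *[A] x) *[A] (inv A (x *[A] y) *[A] x).
Proof.
set p := inv A (x *[A] y).
rewrite -liP (morph_inv _ (liM A p x)).
(* Since [p (x y) = 1], the automorphism [li A p x] sends [y] to the inverse of [p x], hence the
   inverse of [y] to [p x]. *)
have -> : li A p x y = inv A (p *[A] x) by apply: liE; rewrite opV Vop.
by rewrite invK.
Qed.

(** * Condition (C) and comparison of two loops on one carrier *)

Lemma condC_opp T (A : aloop T) : condC (op A) -> condC (op (opp A)).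
Proof.
move=> C a b; split=> /= [e|e].
  by symmetry; apply/C.
by symmetry; apply/C.
Qed.

Lemma tm_tm_comm T (A : aloop T) x u :
  condC (op A) -> tm A x (tm A x u) = u -> comm A x u.
Proof.
move=> C e; apply/C.
by rewrite -{1}e tmP flex tmP.
Qed.

Definition half T (A B : aloop T) :=
  forall x y, x *[B] y = x *[A] y \/ x *[B] y = y *[A] x.

Lemma half_opp T (A B : aloop T) : half A B -> half (opp A) B.
Proof. by move=> H x y; case: (H x y); [right|left]. Qed.

Lemma half_one T (A B : aloop T) : half A B -> one B = one A.
Proof.
move=> H; apply: (@opIl _ A (one B)); rewrite op1r.
by case: (H (one B) (one B)) => <-; rewrite op1l.
Qed.

Lemma half_inv T (A B : aloop T) x : half A B -> inv B x = inv A x.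
Proof.
move=> H; apply: invE; rewrite (half_one H).
by case: (H x (inv A x)) => ->; rewrite ?opV ?Vop.
Qed.

Lemma half_diag T (A B : aloop T) x : half A B -> x *[B] x = x *[A] x.
Proof. by move=> H; case: (H x x). Qed.

(** [line] in B makes [p *[B] (u x)] the square of [b]. In A that square is [p (x u)], and through
    [opp A] it is [u x] times the inverse of [y x]; either value of the B-product cancels to
    commutation. *)
Lemma half_inv_conflict T (A B : aloop T) x y :
  half A B -> condC (op A) ->
  x *[B] y = x *[A] y -> x *[B] inv A y = inv A y *[A] x -> comm A x y.
Proof.
move=> H C exy exV.
set u := inv A y in exV *.
set p := inv A (x *[A] y).
have pE : p = u *[A] inv A x by rewrite /p invM.
have pB : p = u *[B] inv B x by rewrite /p -exy -(half_inv _ H) invM /u !(half_inv _ H).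
set b := p *[A] x.
have bE : b = x *[A] (inv A x *[A] u) by rewrite /b pE opVopr.
have px : p *[B] x = inv A x *[B] (u *[A] x).
  by rewrite pB opVopr opVC exV (half_inv _ H).
(* If B reverses [p] and [x], the two possible values of the B-product in [px] give commutation by
   (C), or [b] again. *)
have [?|pxb] : comm A x y \/ p *[B] x = b.
- case: (H p x) => [->|e]; [by right|].
  case: (H (inv A x) (u *[A] x)) => e'.
  + left; apply/(commV A); apply/C; apply: (@opIl _ A (inv A x)).
    by rewrite -/u -opVC -opVC -opVopr flex -pE -e px e' -opV_comm.
  + right; rewrite px e' bE opVC.
    by have := opVopr A (inv A x) u; rewrite invK.
- by [].
have pu : p *[B] (u *[A] x) = b *[A] b.
  rewrite -(half_diag _ H) -pxb -exV /u -(half_inv y H).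
  have -> : p = inv B (x *[B] y) by rewrite exy (half_inv _ H).
  exact: line.
case: (H p (u *[A] x)); rewrite pu => e.
- apply/(commV A); rewrite /comm -/u.
  by apply: (@opIl _ A p); rewrite -e /u line.
- have L := line (opp A) x y; rewrite !inv_opp /= -/u in L.
  rewrite /comm -(invK A (x *[A] y)) -(invK A (y *[A] x)); congr (inv A _).
  apply: (@opIl _ A (u *[A] x)); rewrite -/p -e L.
  by rewrite (_ : x *[A] inv A (y *[A] x) = b) // bE invM.
Qed.

(** For noncommuting [x], [y], agreement passes to [x] and the inverse of [y]; inverting gives [y]
    and the inverse of [x], and a second pass gives [(y, x)]. *)
Lemma half_swap T (A B : aloop T) x y :
  half A B -> condC (op A) -> x *[B] y = x *[A] y -> y *[B] x = y *[A] x.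
Proof.
move=> H C exy.
have [c|nc] := classic (comm A x y); first by case: (H y x) => ->.
have exV : x *[B] inv A y = x *[A] inv A y.
  by case: (H x (inv A y)) => // e; case: nc; exact: half_inv_conflict H C exy e.
have eyV : y *[B] inv A x = y *[A] inv A x.
  have := congr1 (inv A) exV.
  by rewrite -{1}(half_inv _ H) -(half_inv y H) !invM !(half_inv _ H) !invK.
case: (H y x) => // e; case: nc; apply/commC/(commV A).
by apply: (half_inv_conflict H C eyV); rewrite invK.
Qed.

(** * Iso and anti pairs, and the maps T_x of both loops *)

(** Anti pairs are [iso (opp A) B]; noncommutation makes the two kinds exclusive. *)
Definition iso T (A B : aloop T) x y := ~ comm A x y /\ x *[B] y = x *[A] y.

Lemma iso_or T (A B : aloop T) x y :
  half A B -> ~ comm A x y -> iso A B x y \/ iso (opp A) B x y.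
Proof.
move=> H nc; case: (H x y) => e; [left|right]; split=> //.
exact: not_eq_sym.
Qed.

Lemma iso_sym T (A B : aloop T) x y :
  half A B -> condC (op A) -> iso A B x y -> iso A B y x.
Proof. by move=> H C [nc e]; split; [exact: not_eq_sym | exact: half_swap]. Qed.

Lemma tm_inj T (A : aloop T) x : injective (tm A x).
Proof.
move=> u v e; have := congr1 (op A x) e.
by rewrite !tmP; exact: opIr.
Qed.

Lemma tmoK T (A : aloop T) x : cancel (tm (opp A) x) (tm A x).
Proof. by move=> u; apply: tmE; exact/esym/(tmP (opp A)). Qed.

Lemma tmKo T (A : aloop T) x : cancel (tm A x) (tm (opp A) x).
Proof. by move=> u; apply: (@tm_inj _ A x); rewrite tmoK. Qed.

Lemma tmMo T (A : aloop T) x u v :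
  tm (opp A) x (u *[A] v) = tm (opp A) x u *[A] tm (opp A) x v.
Proof. exact: (tmM (opp A)). Qed.

Lemma iso_tm T (A B : aloop T) x y :
  half A B -> condC (op A) -> iso A B x y ->
  tm B x y = tm A x y /\ iso A B x (tm A x y).
Proof.
move=> H C [nc e]; have e' := half_swap H C e.
have nc' : ~ comm A x (tm A x y).
  by move=> c; apply: nc; apply/tm_comm; apply: (@tm_inj _ A x); exact/tm_comm.
have [i|/(iso_sym (half_opp H) (condC_opp C)) [_ /= e2]] := iso_or H nc'.
- split=> //; apply: tmE; rewrite (proj2 i) tmP; exact/esym.
(* Were T_x y anti with [x], it and [y] would have the same B-product with [x]. *)
- case: nc; apply/tm_comm; apply: (@opIr _ B x).
  by rewrite e2 tmP.
Qed.

Lemma tm_half T (A B : aloop T) x w : half A B -> condC (op A) ->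
  tm B x w = tm A x w \/ tm B x w = tm (opp A) x w.
Proof.
move=> H C; have [c|nc] := classic (comm A x w).
- left; rewrite (proj1 (tm_comm A x w) c); apply: tmE.
  by case: (H x w) => ->; case: (H w x) => ->.
- case: (iso_or H nc) => i; [left|right].
  + exact: (proj1 (iso_tm H C i)).
  + exact: (proj1 (iso_tm (half_opp H) (condC_opp C) i)).
Qed.

Lemma tm_half2 T (A B : aloop T) x w : half A B -> condC (op A) ->
  tm B x w = tm A x w -> tm B x (tm B x w) = tm A x (tm A x w).
Proof.
move=> H C e; have [c|nc] := classic (comm A x w).
  by rewrite e (proj1 (tm_comm A x w) c) e (proj1 (tm_comm A x w) c).
have [i|i] := iso_or H nc.
  have [_ i'] := iso_tm H C i.
  by rewrite e; case: (iso_tm H C i').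
have [e' _] := iso_tm (half_opp H) (condC_opp C) i.
case: nc; apply: (tm_tm_comm C).
by rewrite -e e' tmoK.
Qed.

(** * Excluding elements of mixed type *)

Lemma tm_neq T (A B : aloop T) x w : condC (op A) -> iso A B x w ->
  tm A x w <> tm (opp A) x w.
Proof.
move=> C [nc _] e; apply: nc; apply: (tm_tm_comm C).
by rewrite e tmoK.
Qed.

(** Otherwise T_x of B sends [y z] to T_x y times T_x^-1 z, while by [tm_half] the image is that of
    T_x or T_x^-1 of A; cancelling contradicts [tm_neq]. *)
Lemma flip T (A B : aloop T) x y z :
  half A B -> condC (op A) -> iso A B x y -> iso (opp A) B x z ->
  y *[B] z = y *[A] z ->
  tm A x y *[B] tm (opp A) x z <> tm A x y *[A] tm (opp A) x z.
Proof.
move=> H C iy iz e e'.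
have [ey _] := iso_tm H C iy.
have [ez _] := iso_tm (half_opp H) (condC_opp C) iz.
have E := tmM B x y z; rewrite ey ez e e' in E.
case: (tm_half x (y *[A] z) H C); rewrite E.
- rewrite tmM => h; have k := opIl h.
  exact: (tm_neq (condC_opp C) iz k).
- rewrite tmMo => h; have k := opIr h.
  exact: (tm_neq C iy k).
Qed.

Lemma quad_plus T (A B : aloop T) x y z :
  half A B -> condC (op A) -> iso A B x y -> iso (opp A) B x z ->
  y *[B] z = y *[A] z ->
  let s := tm A x in let s' := tm (opp A) x in
  s (s y) = s' (s' y) /\ s (s z) = s' (s' z) /\
  ((s (s z) *[A] y = y *[A] z /\ s (s y) *[A] z = z *[A] y /\
    iso A B x (y *[A] z)) \/
   (y *[A] s (s z) = z *[A] y /\ z *[A] s (s y) = y *[A] z /\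
    iso A B x (z *[A] y))).
Proof.
move=> H C iy iz e s s'.
have Ho := half_opp H; have Co := condC_opp C.
have e' := half_swap H C e.
have [ey iy1] := iso_tm H C iy; have [ez iz1] := iso_tm Ho Co iz.
have [ey2 _] := iso_tm H C iy1; have [ez2 _] := iso_tm Ho Co iz1.
rewrite -/s in ey iy1 ey2; rewrite -/s' in ez iz1 ez2.
have f1 := flip H C iy iz e; rewrite -/s -/s' in f1.
have g1 : s y *[B] s' z = s' z *[A] s y by case: (H (s y) (s' z)).
have g1' : s' z *[B] s y = s y *[A] s' z by exact: (half_swap Ho Co g1).
have ncyz : ~ comm A (s y) (s' z) by move=> c; apply: f1; rewrite g1.
have g2 : s (s y) *[B] s' (s' z) = s (s y) *[A] s' (s' z).
  have := @flip _ (opp A) B x (s' z) (s y) Ho Co iz1 iy1 g1'.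
  rewrite -/s' -/s => f2.
  have [//|k] := H (s (s y)) (s' (s' z)).
  by case: f2; exact: (half_swap Ho Co k).
have g2' := half_swap H C g2.
have sK w : s (s' w) = w by exact: tmoK.
have s'K w : s' (s w) = w by exact: tmKo.
have sM u v : s (u *[A] v) = s u *[A] s v by exact: tmM.
have s'M u v : s' (u *[A] v) = s' u *[A] s' v by exact: tmMo.
set p := y *[A] z; set q := z *[A] y.
have tp : tm B x p = s' z *[A] s y by rewrite /p -e tmM ey ez.
have tq : tm B x q = s y *[A] s' z by rewrite /q -e' tmM ey ez.
have tp2 : tm B x (tm B x p) = s (s y) *[A] s' (s' z).
  by rewrite tp -g1 tmM ey2 ez2.
have tq2 : tm B x (tm B x q) = s' (s' z) *[A] s (s y).
  by rewrite tq -g1' tmM ey2 ez2.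
(* Otherwise T_(s y) would exchange [s' z] and [s z], and (C) would make [s y] and [s' z] commute.
   So exactly one of [p], [q] follows [s]. *)
have no33 : tm B x p = s p -> tm B x q = s q -> False.
  rewrite tp tq /p /q !sM => h3 h3'.
  apply: ncyz; apply: (tm_tm_comm C).
  by rewrite (tmE (esym h3)); apply: tmE.
have no44 : tm B x p = s' p -> tm B x q = s' q -> False.
  rewrite tp tq /p /q !s'M => h4 h4'.
  apply: ncyz; apply: commC; apply: (tm_tm_comm C).
  by rewrite (tmE (esym h4')); apply: tmE.
have isoW w : tm B x w = s w -> tm B x w <> s' w -> iso A B x w.
  move=> hw hw'.
  have nc : ~ comm A x w.
    move=> c; apply: hw'; rewrite hw /s (proj1 (tm_comm A x w) c).
    by rewrite /s' (proj1 (tm_comm (opp A) x w) (esym c)).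
  case: (iso_or H nc) => // i; case: hw'.
  exact: (proj1 (iso_tm Ho Co i)).
case: (tm_half x p H C) => hp; case: (tm_half x q H C) => hq.
- by case: no33.
- have yy : s (s y) = s' (s' y).
    have := tm_half2 Ho Co hq; rewrite tq2 -/s' /q !s'M.
    exact: opIl.
  have zz : s (s z) = s' (s' z).
    have := tm_half2 H C hp; rewrite tp2 -/s /p !sM.
    by move=> h; rewrite (opIl h).
  split=> //; split=> //; left; split; last split.
  + have := congr1 s' (esym hp); rewrite tp -/s s'K /p zz s'M.
    by rewrite s'K => ->.
  + have := congr1 s (esym hq); rewrite tq -/s' sK /q sM.
    by rewrite sK => ->.
  + by apply: isoW => // k; exact: no44 k hq.
- have yy : s (s y) = s' (s' y).
    have := tm_half2 Ho Co hp; rewrite tp2 -/s' /p !s'M.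
    exact: opIr.
  have zz : s (s z) = s' (s' z).
    have := tm_half2 H C hq; rewrite tq2 -/s /q !sM.
    by move=> h; rewrite (opIr h).
  split=> //; split=> //; right; split; last split.
  + have := congr1 s' (esym hq); rewrite tq -/s s'K /q zz s'M.
    by rewrite s'K => ->.
  + have := congr1 s (esym hp); rewrite tp -/s' sK /p sM.
    by rewrite sK => ->.
  + by apply: isoW => // k; exact: no44 hp k.
- by case: no44.
Qed.

Lemma quad T (A B : aloop T) x y z :
  half A B -> condC (op A) -> iso A B x y -> iso (opp A) B x z ->
  let s := tm A x in let s' := tm (opp A) x in
  s (s y) = s' (s' y) /\
  ((s (s z) *[A] y = y *[A] z /\ s (s y) *[A] z = z *[A] y) \/
   (y *[A] s (s z) = z *[A] y /\ z *[A] s (s y) = y *[A] z)).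
Proof.
move=> H C iy iz s s'.
have Ho := half_opp H; have Co := condC_opp C.
case: (H y z) => e.
  case: (quad_plus H C iy iz e) => yy [_ [[? [? _]]|[? [? _]]]].
    by split=> //; left.
  by split=> //; right.
have := @quad_plus _ (opp A) B x z y Ho Co iz iy (half_swap Ho Co e).
case=> zz [yy]; rewrite -/s -/s' in zz yy *; rewrite zz yy.
case=> [[? [? _]]|[? [? _]]].
  by split=> //; right.
by split=> //; left.
Qed.

Lemma no_mix_plus T (A B : aloop T) x y z :
  half A B -> condC (op A) -> iso A B x y -> iso (opp A) B x z ->
  y *[B] z <> y *[A] z.
Proof.
move=> H C iy iz e.
have Ho := half_opp H; have Co := condC_opp C.
set s := tm A x; set t := tm A z.
have sM u v : s (u *[A] v) = s u *[A] s v by exact: tmM.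
have f1 := flip H C iy iz e.
(* If they commuted, [flip] in A and in [opp A] would exclude both values of the B-product of T_x y
   and T_x^-1 z. *)
have ncyz : ~ comm A y z.
  move=> c.
  have e2 : z *[B] y = y *[A] z by rewrite (half_swap H C e).
  have f2 := @flip _ (opp A) B x z y Ho Co iz iy e2.
  case: (H (tm A x y) (tm (opp A) x z)) => [//|k].
  by case: f2; exact: (half_swap Ho Co k).
have izy : iso A B z y by apply: (iso_sym H C).
have izx : iso (opp A) B z x by exact: (iso_sym Ho Co).
have [t4 _] := quad H C izy izx; rewrite -/t in t4.
have tt4 : t (t (t (t y))) = y by rewrite t4 /t !tmoK.
suff t3 : t (t (t y)) = y.
  by rewrite t3 in tt4; apply: ncyz; apply: commC; apply/tm_comm.
have nz : s (s z) = z -> False.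
  by move=> k; case: iz => nc _; apply: nc; apply: commC; exact: (tm_tm_comm C k).
have tE u w : z *[A] w = u *[A] z -> t u = w by exact: tmE.
have tP u : u *[A] z = z *[A] t u by rewrite tmP.
have [yy [zz]] := quad_plus H C iy iz e.
rewrite -/s in yy zz *.
have sy4 : s (s (s (s y))) = y by rewrite yy /s !tmoK.
have sz4 : s (s (s (s z))) = z by rewrite zz /s !tmoK.
case=> [[I1 [I2 ip]]|[I1 [I2 ip]]].
- have J := congr1 s (congr1 s I1); rewrite !sM sz4 in J.
  (* With the product [y z] in place of [y], one relation gives [s (s z) = z], excluded by [nz]; the
     other gives [t (t y) = s (s y)], and [t (s (s y)) = y] by [I2]. *)
  have [_ [[_ k]|[_ k]]] := quad H C ip iz; rewrite -/s !sM in k.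
  + case: nz; apply: (@opIl _ A (s (s y))); rewrite I2.
    by apply: (@opIr _ A z); rewrite k flex.
  + rewrite -J (tP y) -flex in k.
    by rewrite (tE _ _ (opIl k)) (tE _ _ (esym I2)).
- have J := congr1 s (congr1 s I1); rewrite !sM sz4 in J.
  have [_ [[_ k]|[_ k]]] := quad H C ip iz; rewrite -/s !sM in k.
  + rewrite -J (tP (s (s y))) -flex in k.
    by rewrite (tE _ _ I2) (tE _ _ (esym (opIl k))).
  + rewrite -flex in k.
    by case: nz; apply: (@opIr _ A (s (s y))); rewrite (opIl k) I2.
Qed.

Lemma no_mix T (A B : aloop T) x y z :
  half A B -> condC (op A) -> iso A B x y -> iso (opp A) B x z -> False.
Proof.
move=> H C iy iz; have Ho := half_opp H; have Co := condC_opp C.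
case: (H y z) => e; first exact: (no_mix_plus H C iy iz e).
exact: (@no_mix_plus _ (opp A) B x z y Ho Co iz iy (half_swap Ho Co e)).
Qed.

(** * From unmixed elements to triviality *)

Lemma half_trivial T (A B : aloop T) : half A B -> condC (op A) ->
  (forall x y, x *[B] y = x *[A] y) \/ (forall x y, x *[B] y = y *[A] x).
Proof.
move=> H C; have Ho := half_opp H; have Co := condC_opp C.
have [[a [b ab]]|noanti] := classic (exists a b, iso (opp A) B a b); last first.
  left=> x y; case: (H x y) => // e.
  have [c|nc] := classic (comm A x y); first by rewrite e.
  by case: noanti; exists x, y; split=> //; exact: not_eq_sym.
right=> x y; case: (H x y) => // e.
have [c|nc] := classic (comm A x y); first by rewrite e.
have xy : iso A B x y by [].
exfalso.
have ba := iso_sym Ho Co ab; have yx := iso_sym H C xy.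
(* If [c] and [u] did not commute, the type of that pair would make one of them mixed. *)
have cross c d u v : iso A B c d -> iso (opp A) B u v -> comm A c u.
  move=> cd uv; apply: NNPP => n.
  have [i|i] := iso_or H n; first exact: (no_mix H C (iso_sym H C i) uv).
  exact: (no_mix H C cd i).
have ax : comm A a x := commC (cross _ _ _ _ xy ab).
have ay : comm A a y := commC (cross _ _ _ _ yx ab).
have bx : comm A b x := commC (cross _ _ _ _ xy ba).
have by_ : comm A b y := commC (cross _ _ _ _ yx ba).
(* [a *[A] x] is mixed: it is anti with [b] and iso with [y]. *)
set u := a *[A] x.
have bu : ~ comm A b u.
  move/tm_comm; rewrite /u tmM (proj1 (tm_comm A b x) bx) => h.
  have c : comm A b a by apply/tm_comm; exact: opIr h.
  by case: ba => n _; exact: n (esym c).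
have yu : ~ comm A y u.
  move/tm_comm; rewrite /u tmM (proj1 (tm_comm A y a) (commC ay)) => h.
  by case: yx => n _; apply: n; apply/tm_comm; exact: opIl h.
have [i|i] := iso_or H bu; first by case: (no_mix H C i ba).
have [j|j] := iso_or H yu; last by case: (no_mix H C yx j).
case: (@no_mix _ A B u y b H C); first exact: (iso_sym H C).
exact: (iso_sym Ho Co).
Qed.

(** * Passage between the stated definitions and [aloop] *)

Lemma aloop_of T (m : T -> T -> T) e :
  automorphic_loop m e -> exists A : aloop T, op A = m.
Proof.
case=> [[dl [dr id]] aut].
have i1 x : m e x = x by case: (id x).
have i2 x : m x e = x by case: (id x).
have uex (P : T -> Prop) : (exists! x, P x) -> {x | P x}.
  by move=> h; apply: constructive_definite_description.
pose l a b := proj1_sig (uex _ (dl a b)).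
pose r b a := proj1_sig (uex _ (dr a b)).
have ml a b : m a (l a b) = b by exact: (proj2_sig (uex _ (dl a b))).
have mr b a : m (r b a) a = b by exact: (proj2_sig (uex _ (dr a b))).
have lm a b : l a (m a b) = b.
  by have [w [_ U]] := dl a (m a b); rewrite -(U (l a (m a b))) ?ml //; exact: U.
have rm b a : r (m b a) a = b.
  by have [w [_ U]] := dr a (m b a); rewrite -(U (r (m b a) a)) ?mr //; exact: U.
have innM g : mlt m g -> g e = e -> forall u v, g (m u v) = m (g u) (g v).
  by move=> mg ge; case: (aut g (conj mg ge)).
have hT x u v : l x (m (m u v) x) = m (l x (m u x)) (l x (m v x)).
  apply: (innM (fun u => l x (m u x))); last by rewrite i1 -{2}(i2 x) lm.
  apply: (@mlt_Linv _ _ (fun u => m u x) (l x) x) => //.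
    by apply: mlt_R; exact: mlt_id.
have hL x y u v : l (m x y) (m x (m y (m u v))) =
    m (l (m x y) (m x (m y u))) (l (m x y) (m x (m y v))).
  apply: (innM (fun u => l (m x y) (m x (m y u)))).
    apply: (@mlt_Linv _ _ (fun u => m x (m y u)) (l (m x y)) (m x y)) => //.
    by do 2!apply: mlt_L; exact: mlt_id.
  by rewrite i2 -{2}(i2 (m x y)) lm.
have hR x y u v : r (m (m (m u v) x) y) (m x y) =
    m (r (m (m u x) y) (m x y)) (r (m (m v x) y) (m x y)).
  apply: (innM (fun u => r (m (m u x) y) (m x y))).
    apply: (@mlt_Rinv _ _ (fun u => m (m u x) y) (fun u => r u (m x y)) (m x y)) => //.
    by do 2!apply: mlt_R; exact: mlt_id.
  by rewrite i1 -{1}(i1 (m x y)) rm.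
by exists (@ALoop T m e l r ml lm (fun a b => mr b a) (fun a b => rm b a) i1 i2 hT hL hR).
Qed.

(** Carrying the first loop along [f] turns the half-isomorphism into [half] on a single carrier. *)
Lemma transport T T' (A : aloop T) (f : T -> T') g : cancel f g -> cancel g f ->
  exists B : aloop T', op B = fun a b => f (g a *[A] g b).
Proof.
move=> fK gK.
refine (ex_intro _ (@ALoop T' (fun a b => f (g a *[A] g b)) (f (one A))
  (fun a b => f (ld A (g a) (g b))) (fun a b => f (rd A (g a) (g b)))
  _ _ _ _ _ _ _ _ _) erefl) => *; rewrite !fK.
- by rewrite opld gK.
- by rewrite ldop gK.
- by rewrite oprd gK.
- by rewrite rdop gK.
- by rewrite op1l gK.
- by rewrite op1r gK.
- by rewrite inT.
- by rewrite inL.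
- by rewrite inR.
Qed.

Theorem theorem4p1 (Q Q' : Type) (mul : Q -> Q -> Q) (e : Q)
  (mul' : Q' -> Q' -> Q') (e' : Q') (f : Q -> Q') :
  automorphic_loop mul e -> automorphic_loop mul' e' ->
  half_isomorphism mul mul' f ->
  condC mul' ->
  isomorphism mul mul' f \/ anti_isomorphism mul mul' f.
Proof.
move=> hQ hQ'; have [A0 <-] := aloop_of hQ; have [A <-] := aloop_of hQ'.
move=> [bf hf] C.
have [g fK gK] := bf.
have [B BE] := transport A0 fK gK.
have fM x y : f (x *[A0] y) = f x *[B] f y by rewrite BE !fK.
have H : half A B.
  by move=> a b; rewrite -(gK a) -(gK b) -fM; exact: hf.
by case: (half_trivial H C) => h; [left|right]; split=> // x y; rewrite fM.
Qed.
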